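(* Let $n\ge1$, $\alpha_1,\dots,\alpha_n\in\mathbb{R}$, and for $x=(x_1,\dots,x_n)\in(\mathbb{R}^+)^n$ let $R(x)=\prod_{i=1}^nx_i^{\alpha_i}$ and $J(x)=\tfrac12\left(R(x)+R(x)^{-1}\right)-1$. Then $J$ is the symmetrized Itakura--Saito divergence applied to $R(x)$: for all $x\in(\mathbb{R}^+)^n$, $$J(x)=\tfrac12\Bigl(D_{\mathrm{IS}}(1\,\|\,R(x))+D_{\mathrm{IS}}(R(x)\,\|\,1)\Bigr).$$
   Context: $\mathbb{R}^+$ denotes the positive reals. For $p,q>0$ the Itakura--Saito divergence is $D_{\mathrm{IS}}(p\|q)=\frac{p}{q}-\log\left(\frac{p}{q}\right)-1$. *)

(* Defs.v *)
From HB Require Import structures.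
From mathcomp Require Import all_boot all_order all_algebra.
From mathcomp Require Import reals exp.

Set Implicit Arguments.
Unset Strict Implicit.
Unset Printing Implicit Defensive.

Import Order.TTheory GRing.Theory Num.Theory.

Local Open Scope ring_scope.

(* Total functions, meant for positive arguments (resp. vectors with positive
   coordinates), where [ln], [`^] and the inverse have their usual values. *)

Definition itakura_saito (R : realType) (p q : R) : R :=
  p / q - ln (p / q) - 1.

Definition weighted_ratio (R : realType) (n : nat) (alpha x : 'rV[R]_n) : R :=
  \prod_(i < n) (x 0 i `^ alpha 0 i).

Definition ratio_cost (R : realType) (n : nat) (alpha x : 'rV[R]_n) : R :=
  2^-1 * (weighted_ratio alpha x + (weighted_ratio alpha x)^-1) - 1.

(* Main.v *)
Require Import Defs.
From HB Require Import structures.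
From mathcomp Require Import all_boot all_order all_algebra.
From mathcomp Require Import reals exp.
From mathcomp Require Import ring.

Import Order.TTheory GRing.Theory Num.Theory.

Local Open Scope ring_scope.

(** The identity depends only on the number [r = weighted_ratio alpha x], which is positive. In the
    sum of the two divergences the logarithms of [r^-1] and [r] are opposite and cancel, leaving
    [r + r^-1 - 2] ([itakura_saito_sym1]); half of this is the cost. *)

Lemma weighted_ratio_gt0 (R : realType) (n : nat) (alpha x : 'rV[R]_n) :
  (forall i : 'I_n, 0 < x 0 i) -> 0 < weighted_ratio alpha x.
Proof. by move=> x_gt0; apply: prodr_gt0 => i _; apply: powR_gt0. Qed.

Lemma itakura_saito_sym1 (R : realType) (r : R) : 0 < r ->
  itakura_saito 1 r + itakura_saito r 1 = r + r^-1 - 2.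
Proof.
(* Positivity of [r] enters through [lnV], which turns [ln r^-1] into [- ln r]; [ring] then cancels
   [ln r] as an atom. *)
move=> r_gt0; rewrite /itakura_saito div1r divr1 lnV ?posrE //.
by ring.
Qed.

Theorem mainTheorem4 (R : realType) (n : nat) (hn : (1 <= n)%N)
    (alpha : 'rV[R]_n) :
  forall x : 'rV[R]_n, (forall i : 'I_n, 0 < x 0 i) ->
    ratio_cost alpha x =
      2^-1 * (itakura_saito 1 (weighted_ratio alpha x)
              + itakura_saito (weighted_ratio alpha x) 1).
Proof.
move=> x x_gt0; rewrite itakura_saito_sym1; last exact: weighted_ratio_gt0.
(* The [- 1] of the cost is [2^-1] times the [- 2] left by the two divergences. *)
by rewrite /ratio_cost mulrBr mulVf ?pnatr_eq0.
Qed.
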